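(* Let $\mathbf{X}_1,\mathbf{X}_2,\mathbf{X}_3$ be (possibly different) BNM schemes, and let $\mathbb{SS}$, $\mathbb{TT}$, $\mathbb{TS}$ be the sets of inferences valid according to the standard $\mathbf{ss}$ over $\mathbf{X}_1$, the standard $\mathbf{tt}$ over $\mathbf{X}_2$, and the standard $\mathbf{ts}$ over $\mathbf{X}_3$, respectively. Then the set $$\{\mathbb{TS}^{\star},\ \mathbb{SS}^{\star},\ \mathbb{TT}^{\star},\ \mathbb{SS}^{\star}\cup\mathbb{TT}^{\star}\},$$ partially ordered by inclusion $\subseteq$, is a lattice, with infimum $\inf\{\mathbb{X}^{\star},\mathbb{Y}^{\star}\}=T^d(\mathbb{X}^{\star}\cap\mathbb{Y}^{\star})$ and supremum $\sup\{\mathbb{X}^{\star},\mathbb{Y}^{\star}\}=\mathbb{X}^{\star}\cup\mathbb{Y}^{\star}$ for all elements $\mathbb{X}^{\star},\mathbb{Y}^{\star}$ of the set, where $T^d$ denotes dual transitive closure.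
   Context: Formulas: the propositional language $\mathcal{L}$ is built from a denumerably infinite set $\mathit{Var}$ of propositional variables using only $\neg$, $\lor$, $\wedge$ (no propositional constants). An inference $\Gamma\Rightarrow\phi$ is an ordered pair $\langle\Gamma,\phi\rangle$ with $\Gamma\subseteq\mathcal{L}$ finite (possibly empty) and $\phi\in\mathcal{L}$. Schemes: a (three-valued) scheme $\mathbf{X}$ is a triple $(f_\neg,f_\wedge,f_\vee)$ of operations on $\{0,\frac12,1\}$ (unary, binary, binary). It is Boolean normal if each operation, restricted to arguments in $\{0,1\}$, agrees with the corresponding operation of the two-element Boolean algebra. Let $\leq_{\rm I}$ be the partial order on $\{0,\frac12,1\}$ whose strict part is $\frac12<_{\rm I}0$ and $\frac12<_{\rm I}1$. The scheme is monotonic if each of its operations is monotone from the componentwise order induced by $\leq_{\rm I}$ to $\leq_{\rm I}$. A BNM scheme is a Boolean normal monotonic scheme. An $\mathbf{X}$-valuation is a map $v:\mathcal{L}\to\{0,\frac12,1\}$ such that $v(\neg\phi)=f_\neg(v(\phi))$, $v(\phi\wedge\psi)=f_\wedge(v(\phi),v(\psi))$, $v(\phi\vee\psi)=f_\vee(v(\phi),v(\psi))$. Standards: let $\mathbf{s}=\{1\}$ and $\mathbf{t}=\{1,\frac12\}$. For $\mathbf{x},\mathbf{y}\in\{\mathbf{s},\mathbf{t}\}$, a valuation $v$ satisfies $\Gamma\Rightarrow\phi$ according to $\mathbf{xy}$ if: whenever $v(\gamma)\in\mathbf{x}$ for all $\gamma\in\Gamma$, then $v(\phi)\in\mathbf{y}$.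 An inference is valid according to $\mathbf{xy}$ over $\mathbf{X}$ if it is satisfied according to $\mathbf{xy}$ by every $\mathbf{X}$-valuation. Theorems and antitheorems: for a set of inferences $\mathbb{L}$, $\mathbb{L}^{\star}:=\{\Gamma\Rightarrow\phi : \Gamma\Rightarrow\psi\in\mathbb{L}\text{ for all }\psi\in\mathcal{L},\text{ or }\Delta\Rightarrow\phi\in\mathbb{L}\text{ for all finite }\Delta\subseteq\mathcal{L}\}$. Dual transitive closure: for a set of inferences $\mathbb{L}$, $T^d(\mathbb{L})$ is the greatest set $\mathbb{L}'\subseteq\mathbb{L}$ such that, for all inferences $\Gamma\Rightarrow\phi$: if there is a finite $\Delta\neq\emptyset$ with $\Delta\Rightarrow\phi\notin\mathbb{L}'$ and $\Gamma\Rightarrow\delta\notin\mathbb{L}'$ for all $\delta\in\Delta$, then $\Gamma\Rightarrow\phi\notin\mathbb{L}'$. *)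

(* Defs.v *)
From HB Require Import structures.
From mathcomp Require Import all_boot finmap.
From mathcomp Require Import boolp classical_sets.

Set Implicit Arguments.
Unset Strict Implicit.
Unset Printing Implicit Defensive.

Local Open Scope classical_set_scope.

Inductive form : Type :=
  | Var of nat
  | Neg of form
  | And of form & form
  | Or of form & form.

Fixpoint tree_of_form (f : form) : GenTree.tree nat :=
  match f with
  | Var n => GenTree.Leaf n
  | Neg a => GenTree.Node 0 [:: tree_of_form a]
  | And a b => GenTree.Node 1 [:: tree_of_form a; tree_of_form b]
  | Or a b => GenTree.Node 2 [:: tree_of_form a; tree_of_form b]
  end.

Fixpoint form_of_tree (t : GenTree.tree nat) : form :=
  match t with
  | GenTree.Leaf n => Var n
  | GenTree.Node 0 [:: a] => Neg (form_of_tree a)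
  | GenTree.Node 1 [:: a; b] => And (form_of_tree a) (form_of_tree b)
  | GenTree.Node 2 [:: a; b] => Or (form_of_tree a) (form_of_tree b)
  | _ => Var 0
  end.

Lemma tree_of_formK : cancel tree_of_form form_of_tree.
Proof. by elim=> //= [a -> | a -> b -> | a -> b ->]. Qed.

HB.instance Definition _ := Countable.copy form (can_type tree_of_formK).

Definition inference : Type := ({fset form} * form)%type.

Inductive tv : Type := Zero | Half | One.

Definition tv_of_bool (b : bool) : tv := if b then One else Zero.

Definition ltI (x y : tv) : Prop := x = Half /\ (y = Zero \/ y = One).

Definition leI (x y : tv) : Prop := x = y \/ ltI x y.

Record scheme : Type := Scheme {
  f_neg : tv -> tv;
  f_and : tv -> tv -> tv;
  f_or : tv -> tv -> tv }.

Definition boolean_normal (X : scheme) : Prop :=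
  [/\ forall a, f_neg X (tv_of_bool a) = tv_of_bool (~~ a),
      forall a b, f_and X (tv_of_bool a) (tv_of_bool b) = tv_of_bool (a && b)
    & forall a b, f_or X (tv_of_bool a) (tv_of_bool b) = tv_of_bool (a || b)].

Definition monotonic (X : scheme) : Prop :=
  [/\ forall x x', leI x x' -> leI (f_neg X x) (f_neg X x'),
      forall x x' y y', leI x x' -> leI y y' ->
        leI (f_and X x y) (f_and X x' y')
    & forall x x' y y', leI x x' -> leI y y' ->
        leI (f_or X x y) (f_or X x' y')].

Definition BNM (X : scheme) : Prop := boolean_normal X /\ monotonic X.

Definition valuation (X : scheme) (v : form -> tv) : Prop :=
  [/\ forall a, v (Neg a) = f_neg X (v a),
      forall a b, v (And a b) = f_and X (v a) (v b)
    & forall a b, v (Or a b) = f_or X (v a) (v b)].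

Definition std_s : set tv := [set One].
Definition std_t : set tv := [set One; Half].

Definition satisfies (x y : set tv) (v : form -> tv) (I : inference) : Prop :=
  (forall g, g \in I.1 -> x (v g)) -> y (v I.2).

Definition valid (x y : set tv) (X : scheme) : set inference :=
  [set I | forall v, valuation X v -> satisfies x y v I].

Definition star (L : set inference) : set inference :=
  [set I | (forall psi : form, L (I.1, psi)) \/
           (forall Delta : {fset form}, L (Delta, I.2))].

Definition dual_transitive (L : set inference) : Prop :=
  forall (Gamma : {fset form}) (phi : form),
    (exists Delta : {fset form},
       [/\ Delta <> fset0, ~ L (Delta, phi) &
           forall delta, delta \in Delta -> ~ L (Gamma, delta)]) ->
    ~ L (Gamma, phi).

Definition Td (L : set inference) : set inference :=
  \bigcup_(L' in [set L' | L' `<=` L /\ dual_transitive L']) L'.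

(* The union defining [Td L] is itself a dual-transitive subset of [L], hence
   the greatest one. *)
Lemma Td_greatest (L : set inference) :
  [/\ Td L `<=` L, dual_transitive (Td L) &
      forall L', L' `<=` L -> dual_transitive L' -> L' `<=` Td L].
Proof.
split.
- by move=> I [L' [sub _]] /sub.
- move=> G p [D [D0 nDp nGd]] [L' [sub tr] LGp].
  apply: (tr G p _ LGp); exists D; split=> //.
  + by move=> LDp; apply: nDp; exists L'.
  + by move=> d dD LGd; apply: (nGd d dD); exists L'.
- by move=> L' sub tr I LI; exists L'.
Qed.

Section RelativeLattice.
Variables (T : Type) (le : T -> T -> Prop).

Definition partial_order_on (A : set T) : Prop :=
  [/\ forall a, A a -> le a a,
      forall a b, A a -> A b -> le a b -> le b a -> a = b
    & forall a b c, A a -> A b -> A c -> le a b -> le b c -> le a c].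

(* Bounds are taken within [A], not in the ambient type. *)
Definition is_inf (A : set T) (a b m : T) : Prop :=
  [/\ A m, le m a, le m b & forall c, A c -> le c a -> le c b -> le c m].

Definition is_sup (A : set T) (a b j : T) : Prop :=
  [/\ A j, le a j, le b j & forall c, A c -> le a c -> le b c -> le j c].

Definition is_lattice (A : set T) : Prop :=
  partial_order_on A /\
  forall a b, A a -> A b ->
    (exists m, is_inf A a b m) /\ (exists j, is_sup A a b j).

End RelativeLattice.

(* Main.v *)
Require Import Defs.
From mathcomp Require Import all_boot finmap.
From mathcomp Require Import boolp classical_sets.

(** The three starred logics do not depend on the schemes.  In a Boolean normal
    monotonic scheme, resolving the values [Half] of the variables to classical
    ones never changes a value that is already classical ([leI_resolve]), and a
    formula whose variables all have value [Half] has value [Half]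
    ([valuation_half]).  From the first fact, the premises of an
    inference can all be [One] only if they are classically satisfiable, and a
    formula can be [Zero] only if it is not a classical tautology.  From the
    second, no formula is [One] under all valuations, no inference is valid for
    the standard [ts], and no finite set of premises forces a fresh variable away
    from [Zero] when the premises are only required to be [One] or [Half].  Hence

    - the star of the [ts] logic is empty ([star_valid_ts]),
    - the star of the [ss] logic consists of the inferences with unsatisfiable
      premises ([star_valid_ss]),
    - the star of the [tt] logic consists of the inferences with a tautological
      conclusion ([star_valid_tt]).

    The family is thus the diamond made of the empty set, [antitheorems],
    [theorems] and their union.  It is closed under union, which gives suprema.
    Its members are dual transitive, because membership in [antitheorems] only
    looks at the premises and membership in [theorems] only at the conclusion; so
    any member below both [X] and [Y] is below [Td (X `&` Y)].  It remains that
    [Td (X `&` Y)] is in the family.  If [X] and [Y] are comparable this is the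
    smaller of the two.  Otherwise they are [antitheorems] and [theorems]: their
    intersection is not empty, but a variable, being neither contradictory nor
    tautological, refutes all of its inferences by dual transitivity
    ([Td_antitheorems_theorems]). *)

Local Open Scope classical_set_scope.

(** * Valuations of Boolean normal monotonic schemes *)

Fixpoint eval (X : scheme) (e : nat -> tv) (f : form) : tv :=
  match f with
  | Var n => e n
  | Neg a => f_neg X (eval X e a)
  | And a b => f_and X (eval X e a) (eval X e b)
  | Or a b => f_or X (eval X e a) (eval X e b)
  end.

Lemma valuation_eval (X : scheme) (e : nat -> tv) : valuation X (eval X e).
Proof. by []. Qed.

Fixpoint beval (b : nat -> bool) (f : form) : bool :=
  match f with
  | Var n => b n
  | Neg a => ~~ beval b a
  | And x y => beval b x && beval b y
  | Or x y => beval b x || beval b y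
  end.

Lemma eval_bool {X : scheme} (b : nat -> bool) (f : form) : BNM X ->
  eval X (fun n => tv_of_bool (b n)) f = tv_of_bool (beval b f).
Proof.
move=> [[bN bA bO] _].
by elim: f => [n|x IHx|x IHx y IHy|x IHx y IHy] //=;
  rewrite ?IHx ?IHy ?bN ?bA ?bO.
Qed.

Lemma leI_valuation {X : scheme} {v w : form -> tv} (f : form) :
  monotonic X -> valuation X v -> valuation X w ->
  (forall n, leI (v (Var n)) (w (Var n))) -> leI (v f) (w f).
Proof.
move=> [mN mA mO] [vN vA vO] [wN wA wO] vw.
elim: f => [n|x IHx|x IHx y IHy|x IHx y IHy] //.
- by rewrite vN wN; apply: mN.
- by rewrite vA wA; apply: mA.
- by rewrite vO wO; apply: mO.
Qed.

Lemma leI_half (x : tv) : leI Half x.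
Proof. by case: x; [right; split=> //; left|left|right; split=> //; right]. Qed.

Lemma leI_both {x : tv} : leI x Zero -> leI x One -> x = Half.
Proof. by case: x => // [_|/=] [|[]] // [|[]]. Qed.

(** The value [Half] may be resolved either way; [false] is an arbitrary
    choice. *)
Definition resolve (v : form -> tv) (n : nat) : bool :=
  if v (Var n) is One then true else false.

Lemma leI_resolve {X : scheme} {v : form -> tv} (f : form) :
  BNM X -> valuation X v -> leI (v f) (tv_of_bool (beval (resolve v) f)).
Proof.
move=> hX vX; rewrite -(eval_bool _ _ hX).
apply: (leI_valuation _ hX.2 vX (valuation_eval X _)) => n /=.
by rewrite /resolve; case: (v (Var n)) => /=; [left|apply: leI_half|left].
Qed.

(** A value at [Half] arguments lies below the values at all classical
    arguments, and these include both [Zero] and [One]. *)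
Lemma BNM_half {X : scheme} : BNM X ->
  [/\ f_neg X Half = Half, f_and X Half Half = Half & f_or X Half Half = Half].
Proof.
move=> [[bN bA bO] [mN mA mO]]; split; apply: leI_both.
- by have /= <- := bN true; apply/mN/leI_half.
- by have /= <- := bN false; apply/mN/leI_half.
- by have /= <- := bA false false; apply: mA; apply: leI_half.
- by have /= <- := bA true true; apply: mA; apply: leI_half.
- by have /= <- := bO false false; apply: mO; apply: leI_half.
- by have /= <- := bO true true; apply: mO; apply: leI_half.
Qed.

Fixpoint var_bound (f : form) : nat :=
  match f with
  | Var n => n.+1
  | Neg a => var_bound a
  | And a b => maxn (var_bound a) (var_bound b)
  | Or a b => maxn (var_bound a) (var_bound b)
  end.

Lemma valuation_half {X : scheme} {v : form -> tv} (f : form) :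
  BNM X -> valuation X v ->
  (forall n, n < var_bound f -> v (Var n) = Half) -> v f = Half.
Proof.
move=> /BNM_half[hN hA hO] [vN vA vO].
elim: f => [n|x IHx|x IHx y IHy|x IHx y IHy] /= vh.
- exact: vh.
- by rewrite vN IHx.
- by rewrite vA IHx ?IHy // => n ltn; apply: vh; rewrite leq_max ltn ?orbT.
- by rewrite vO IHx ?IHy // => n ltn; apply: vh; rewrite leq_max ltn ?orbT.
Qed.

Lemma eval_half {X : scheme} (f : form) : BNM X -> eval X (fun=> Half) f = Half.
Proof. by move=> hX; apply: (valuation_half _ hX (valuation_eval X _)). Qed.

(** * Starred logics *)

Definition antitheorems : set inference :=
  [set I | forall b, ~ (forall g, g \in I.1 -> beval b g)].

Definition theorems : set inference := [set I | forall b, beval b I.2].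

Lemma star_valid_ts {X : scheme} : BNM X -> star (valid std_t std_s X) = set0.
Proof.
move=> hX; apply/seteqP; split=> // -[G p].
have invalid D q : ~ valid std_t std_s X (D, q).
  move=> /(_ _ (valuation_eval X (fun=> Half))); rewrite /satisfies /=.
  rewrite /std_s /std_t /= eval_half // => h.
  by have: Half = One by apply: h => g _; right; apply: eval_half.
by move=> [/(_ (Var 0))|/(_ fset0)] /invalid.
Qed.

(** The premises of an antitheorem entail a contradiction, which is [Zero] at every
    classical valuation, so they are classically unsatisfiable.  The second
    disjunct of the star is void, by the valuation that is [Half] everywhere. *)
Lemma star_valid_ss {X : scheme} :
  BNM X -> star (valid std_s std_s X) = antitheorems.
Proof.
move=> hX; apply/seteqP; split=> -[G p].
- move=> [h b /= bG|/(_ fset0 _ (valuation_eval X (fun=> Half)))].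
  + have := h (And (Var 0) (Neg (Var 0))) _
      (valuation_eval X (fun n => tv_of_bool (b n))).
    rewrite /satisfies /std_s !(eval_bool _ _ hX) /= andbN => contra.
    by have: Zero = One by apply: contra => g gG; rewrite eval_bool // bG.
  + rewrite /satisfies /std_s /= eval_half // => h.
    by have: Half = One by apply: h => g; rewrite in_fset0.
- move=> unsat; left=> q v vX /= vG; exfalso.
  apply: (unsat (resolve v)) => g /vG; rewrite /std_s /= => vg.
  have := leI_resolve g hX vX; rewrite vg.
  by case: (beval _ g) => // -[|[]].
Qed.

(** There are no antitheorems here: a contradiction can be [Half] together with all
    premises, and a variable that the premises do not contain can be [Zero]. *)
Lemma star_valid_tt {X : scheme} :
  BNM X -> star (valid std_t std_t X) = theorems.
Proof.
move=> hX; apply/seteqP; split=> -[G p].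
- move=> [h|h b /=].
  + (* [Var N] occurs in no premise: it can be [Zero] while the premises are
       [Half]. *)
    pose N := \max_(g <- G) var_bound g.
    pose e n := if n < N then Half else Zero.
    have premise g : g \in G -> std_t (eval X e g).
      move=> gG; right; apply: (valuation_half _ hX (valuation_eval X e)) => n ltn.
      rewrite /= /e ifT //; apply: leq_trans ltn _.
      exact: leq_bigmax_seq.
    have := h (Var N) _ (valuation_eval X e) premise.
    by rewrite /std_t /= /e ltnn; case.
  + have := h fset0 _ (valuation_eval X (fun n => tv_of_bool (b n))).
    rewrite /satisfies /std_t /= eval_bool // => hp.
    by case: (beval b p) hp => // hp; case: hp => [g|//|//]; rewrite in_fset0.
- move=> taut; right=> D v vX _ /=; rewrite /std_t /=.
  have := leI_resolve p hX vX; rewrite (taut (resolve v)) /=.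
  by case=> [|[]]; [left|right].
Qed.

(** * Dual transitive closure *)

Lemma Td_id {L : set inference} : dual_transitive L -> Td L = L.
Proof.
have [sub _ max] := Td_greatest L.
by move=> tL; apply/seteqP; split=> //; apply: max.
Qed.

Lemma dual_transitive_set0 : dual_transitive set0.
Proof. by move=> ? ? _ []. Qed.

(** Nonemptiness of [Delta] matters here: any of its elements is the conclusion
    of a non-member with premises [Gamma], and being an antitheorem depends on
    the premises only. *)
Lemma dual_transitive_antitheorems : dual_transitive antitheorems.
Proof.
move=> G p [D [/eqP/fset0Pn[d dD] _ nG]] aG.
by case: (nG d dD).
Qed.

Lemma dual_transitive_theorems : dual_transitive theorems.
Proof. by move=> G p [D [_ nDp _]]. Qed.

Lemma dual_transitive_antitheoremsU : dual_transitive (antitheorems `|` theorems).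
Proof.
move=> G p [D [/eqP/fset0Pn[d dD] nDp nG]] [aG|tp].
- by apply: (nG d dD); left.
- by apply: nDp; right.
Qed.

(** Any variable serves as the intermediate formula of dual transitivity: as a
    premise it is satisfiable, as a conclusion it is not a tautology, so neither
    of the two inferences through it lies in the intersection. *)
Lemma Td_antitheorems_theorems : Td (antitheorems `&` theorems) = set0.
Proof.
have [sub tr _] := Td_greatest (antitheorems `&` theorems).
apply/seteqP; split=> // -[G p] LGp.
apply: (tr G p _ LGp); exists [fset Var 0]%fset; split.
- by apply/eqP/fset0Pn; exists (Var 0); rewrite in_fset1.
- move=> /sub[/(_ xpredT) unsat _]; apply: unsat => g.
  by rewrite in_fset1 => /eqP->.
- by move=> d; rewrite in_fset1 => /eqP-> /sub[_ /(_ xpred0)].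
Qed.

(** * The lattice *)

(** A dual transitive set contained in [X] and in [Y] is contained in
    [Td (X `&` Y)], so the greatest-lower-bound property comes for free. *)
Lemma dual_transitive_lattice (F : set (set inference)) :
  (forall X, F X -> dual_transitive X) ->
  (forall X Y, F X -> F Y -> F (Td (X `&` Y))) ->
  (forall X Y, F X -> F Y -> F (X `|` Y)) ->
  is_lattice subset F /\
  forall X Y : set inference, F X -> F Y ->
    is_inf subset F X Y (Td (X `&` Y)) /\ is_sup subset F X Y (X `|` Y).
Proof.
move=> Ftr FI FU.
have bounds X Y : F X -> F Y ->
    is_inf subset F X Y (Td (X `&` Y)) /\ is_sup subset F X Y (X `|` Y).
  move=> FX FY; have [sub _ max] := Td_greatest (X `&` Y); split; split.
  - exact: FI.
  - by move=> I /sub[].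
  - by move=> I /sub[].
  - by move=> Z /Ftr trZ ZX ZY; apply: max => // I ZI; split; [apply: ZX|apply: ZY].
  - exact: FU.
  - exact: subsetUl.
  - exact: subsetUr.
  - by move=> Z _ XZ YZ; rewrite subUset.
split=> //; split.
  split=> [X _ //|X Y _ _ XY YX|X Y Z _ _ _].
  - exact/seteqP.
  - exact: subset_trans.
move=> X Y FX FY; have [inf sup] := bounds X Y FX FY.
by split; [exists (Td (X `&` Y))|exists (X `|` Y)].
Qed.

Definition diamond {T : Type} (A B : set T) : set (set T) :=
  [set set0; A; B; A `|` B].

Lemma diamondU {T : Type} (A B X Y : set T) :
  diamond A B X -> diamond A B Y -> diamond A B (X `|` Y).
Proof.
have in0 : diamond A B set0 by left; left; left.
have inA : diamond A B A by left; left; right.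
have inB : diamond A B B by left; right.
have inU : diamond A B (A `|` B) by right.
move=> [[[]|]|] -> [[[]|]|] ->; rewrite ?set0U ?setU0 ?setUid //.
- by rewrite setUA setUid.
- by rewrite setUC.
- by rewrite setUCA setUid.
- by rewrite setUAC setUid.
- by rewrite -setUA setUid.
Qed.

(** Two members of a diamond are comparable, unless they are its two middle
    elements. *)
Lemma diamondI {T : Type} {A B X Y : set T} :
  diamond A B X -> diamond A B Y ->
  diamond A B (X `&` Y) \/ X `&` Y = A `&` B.
Proof.
have in0 : diamond A B set0 by left; left; left.
have inA : diamond A B A by left; left; right.
have inB : diamond A B B by left; right.
have inU : diamond A B (A `|` B) by right.
have AU : A `<=` A `|` B by exact: subsetUl.
have BU : B `<=` A `|` B by exact: subsetUr.
move=> [[[]|]|] -> [[[]|]|] ->; rewrite ?set0I ?setI0 ?setIid; try by left.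
- by right.
- by left; rewrite setIidl.
- by right; rewrite setIC.
- by left; rewrite setIidl.
- by left; rewrite setIidr.
- by left; rewrite setIidr.
Qed.

Theorem corollary6p10 (X1 X2 X3 : scheme)
    (hX1 : BNM X1) (hX2 : BNM X2) (hX3 : BNM X3) :
  let SS := valid std_s std_s X1 in
  let TT := valid std_t std_t X2 in
  let TS := valid std_t std_s X3 in
  let F : set (set inference) :=
    [set star TS; star SS; star TT; star SS `|` star TT] in
  is_lattice subset F /\
  forall X Y : set inference, F X -> F Y ->
    is_inf subset F X Y (Td (X `&` Y)) /\ is_sup subset F X Y (X `|` Y).
Proof.
move=> SS TT TS F.
have -> : F = diamond antitheorems theorems.
  by rewrite /F star_valid_ts // star_valid_ss // star_valid_tt.
have Ftr X : diamond antitheorems theorems X -> dual_transitive X.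
  move=> [[[]|]|] ->.
  - exact: dual_transitive_set0.
  - exact: dual_transitive_antitheorems.
  - exact: dual_transitive_theorems.
  - exact: dual_transitive_antitheoremsU.
apply: dual_transitive_lattice => // [X Y FX FY|X Y]; last exact: diamondU.
have [FXY|->] := diamondI FX FY.
- by rewrite Td_id //; apply: Ftr.
- by rewrite Td_antitheorems_theorems; left; left; left.
Qed.
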